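(* Let $k>0$ be an integer. (1) For any online $3$-coloring algorithm there exists an ordered set of $k^2$ points in the plane such that, when they are presented in this order, the algorithm produces a monochromatic wedge of size $k$. (2) This is best possible: there exists an online $3$-coloring algorithm which colors any ordered set of $k^2-1$ points in the plane without producing a monochromatic wedge of size $k$.
   Context: A wedge is a set $\{(x,y)\in\mathbb{R}^2 : x<x_0,\ y<y_0\}$ with fixed apex $(x_0,y_0)$, where $x_0=\infty$ and $y_0=\infty$ are also allowed. Given a finite set of colored points in the plane, the size of a wedge is the number of points of the set it contains, and a wedge is monochromatic if all the points of the set it contains have the same color. An online $c$-coloring algorithm is a (deterministic) rule that, when distinct points $p_1,p_2,\ldots$ of the plane arrive one at a time, assigns to $p_i$ on its arrival one of $c$ colors, knowing only $p_1,\ldots,p_i$ and the colors of $p_1,\dots,p_{i-1}$; colors are never changed later and nothing is known about future points. *)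

(* Defs.v *)
From HB Require Import structures.
From mathcomp Require Import all_boot all_order all_algebra.
From mathcomp Require Import boolp classical_sets reals constructive_ereal.

Set Implicit Arguments.
Unset Strict Implicit.
Unset Printing Implicit Defensive.

Local Open Scope classical_set_scope.

Notation plane R := (R * R)%type.

(** The extended reals allow infinite coordinates for the apex; [-oo] is
    excluded since only [+oo] is permitted. *)
Definition is_wedge (R : realType) (W : set (plane R)) : Prop :=
  exists x0 y0 : \bar R,
    [/\ x0 <> -oo%E, y0 <> -oo%E
      & W = [set p | (p.1%:E < x0)%E /\ (p.2%:E < y0)%E]].

(** A colored point set is listed without repetition as pairs (point, color). *)
Definition wedge_size (R : realType) (c : nat)
    (S : seq (plane R * 'I_c)) (W : set (plane R)) : nat :=
  count (fun q => q.1 \in W) S.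

Definition monochromatic (R : realType) (c : nat)
    (S : seq (plane R * 'I_c)) (W : set (plane R)) : Prop :=
  forall q r, q \in S -> r \in S -> W q.1 -> W r.1 -> q.2 = r.2.

Definition has_mono_wedge (R : realType) (c : nat)
    (S : seq (plane R * 'I_c)) (k : nat) : Prop :=
  exists W : set (plane R),
    [/\ is_wedge W, monochromatic S W & wedge_size S W = k].

(** The first argument is the history, i.e. the earlier points in order of
    arrival with their colors, and the second is the point that just arrived.
    The rule is total; its values on histories that never occur are
    irrelevant. *)
Definition online_algorithm (R : realType) (c : nat) : Type :=
  seq (plane R * 'I_c) -> plane R -> 'I_c.

Fixpoint run_from (R : realType) (c : nat) (A : online_algorithm R c)
    (hist : seq (plane R * 'I_c)) (s : seq (plane R)) : seq (plane R * 'I_c) :=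
  if s is p :: s' then run_from A (rcons hist (p, A hist p)) s' else hist.

Definition run (R : realType) (c : nat) (A : online_algorithm R c)
    (s : seq (plane R)) : seq (plane R * 'I_c) :=
  run_from A [::] s.

(* Main.v *)
Require Import Defs.
From HB Require Import structures.
From mathcomp Require Import all_boot all_order all_algebra.
From mathcomp Require Import boolp classical_sets reals constructive_ereal.
From mathcomp Require Import zify lra.

Import Order.TTheory GRing.Theory Num.Theory.

(** Upper bound: a potential argument.  Call a point alive if the closed
    lower-left quadrant at it is monochromatic; only alive points can lie in a
    monochromatic wedge.  The algorithm maintains ([budget]) that for any two
    monochromatic wedges u and v of different colors,

      #alive + C(|u|, 2) + C(|v|, 2) <= #points.

    When p arrives, let x be the largest number such that for each of the three
    colors some wedge of that color around p has at least x points, and give p a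
    color c whose wedges around p have at most x points.  A wedge of color c
    around p can grow from x to x + 1, which raises its binomial by x.
    - If both other colors have wedges of size x + 1 around p, one of them can
      replace the grown wedge in the old inequality, so nothing has to be paid.
    - Otherwise there are at least two candidates for c, and if x > 0 then p has
      wedges of size at least x of all three colors around it.  As these share
      no points, there is a middle one, all of whose points dominate p
      ([middle_wedge]).  A candidate different from its color kills its x or
      more points, and this pays for the growth ([nalive_kill], [good_color]).
    A monochromatic wedge of size k can only arise when p sees three wedges of
    size k - 1 or more.  They contain at least 3 (k - 1) alive points, so before
    p there are at least 3 (k - 1) + 2 C(k - 1, 2) = k ^ 2 - 1 points ([level_bound]).

    Lower bound: the adversary keeps three overlapping wedges ([position]), a
    left, a right and a middle one, monochromatic of three different colors and
    of sizes a, b and m.  The next point is put in all three.  The wedge of its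
    color grows, and the left and the right one, if they have another color, are
    cut to exclude it; only the middle one may be lost ([adversary_step]).  A
    middle pile can take over the role of a side pile ([promote_left]), so at
    most min(a, b) + 1 points raise a or b by one.  Hence at most
    (min(a, b) + 1) max(a, b) + m points have been used at any time
    ([adversary_wins]), and this leads to a wedge of size k within k ^ 2 points.
    Far away points make up the number ([pad]). *)

(** * Colors, wedges and runs *)

Set Implicit Arguments.
Unset Strict Implicit.
Unset Printing Implicit Defensive.

Lemma color_cases (a b c d : 'I_3) :
  a != b -> a != c -> b != c -> [\/ d = a, d = b | d = c].
Proof.
move=> ab ac bc.
have : uniq [:: a; b; c] by rewrite /= !inE negb_or ab ac bc.
move=> /card_uniqP cE.
have : d \in [:: a; b; c].
  have E : #|[:: a; b; c]| = #|'I_3| by rewrite cE card_ord.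
  by rewrite (elimT (subset_cardP E) (subset_predT _)).
by rewrite !inE => /or3P[] /eqP; [constructor 1|constructor 2|constructor 3].
Qed.

Lemma third_color (a b : 'I_3) : exists2 c, c != a & c != b.
Proof.
have [c] : exists c, c \notin [:: a; b].
  apply: contrapT => /forallNP h; have := card_size [:: a; b].
  rewrite (_ : #|[:: a; b]| = 3) // -[RHS]card_ord; apply: eq_card => c.
  by apply/negPn/negP/h.
by rewrite !inE negb_or => /andP[]; exists c.
Qed.

(** An infinite negative coordinate of the apex [u] is harmless: it gives one more
    wedge, the empty one. *)
Definition in_wedge {R : realType} (u : \bar R * \bar R) (p : plane R) : bool :=
  ((p.1%:E < u.1) && (p.2%:E < u.2))%E.

Definition wsize {R : realType} {n} (S : seq (plane R * 'I_n)) u : nat :=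
  count (fun q => in_wedge u q.1) S.

Definition colored {R : realType} {n} (S : seq (plane R * 'I_n)) u (c : 'I_n) :=
  {in S, forall q, in_wedge u q.1 -> q.2 = c}.

Definition dom {R : realType} (p q : plane R) : bool :=
  ((p.1 <= q.1) && (p.2 <= q.2))%R.

(** A point that dominates a point of another color is in no monochromatic wedge
    now or later; the others are the only ones that still matter. *)
Definition alive {R : realType} {n} (S : seq (plane R * 'I_n)) q : bool :=
  all (fun r => dom r.1 q.1 ==> (r.2 == q.2)) S.

Definition nalive {R : realType} {n} (S : seq (plane R * 'I_n)) : nat :=
  count (alive S) S.

Lemma run_rcons (R : realType) n (A : online_algorithm R n) s p :
  run A (rcons s p) = rcons (run A s) (p, A (run A s) p).
Proof.
rewrite /run; elim: s [::] => [//|q s IH] h /=; exact: IH.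
Qed.

Lemma points_run (R : realType) n (A : online_algorithm R n) s :
  map fst (run A s) = s.
Proof.
by elim/last_ind: s => [//|s p IH]; rewrite run_rcons map_rcons IH.
Qed.

Lemma size_run (R : realType) n (A : online_algorithm R n) s :
  size (run A s) = size s.
Proof. by rewrite -{2}(points_run A s) size_map. Qed.

Lemma in_wedge_dom (R : realType) u (p q : plane R) :
  dom p q -> in_wedge u q -> in_wedge u p.
Proof.
move=> /andP[h1 h2] /andP[k1 k2]; apply/andP; split.
- by apply: le_lt_trans k1; rewrite lee_fin.
- by apply: le_lt_trans k2; rewrite lee_fin.
Qed.

Lemma wsize_rcons (R : realType) n (S : seq (plane R * 'I_n)) q u :
  wsize (rcons S q) u = in_wedge u q.1 + wsize S u.
Proof. by rewrite /wsize -cats1 count_cat /= addn0 addnC. Qed.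

Lemma colored_rcons (R : realType) n (S : seq (plane R * 'I_n)) q u c :
  colored (rcons S q) u c <-> colored S u c /\ (in_wedge u q.1 -> q.2 = c).
Proof.
split=> [h|[h h'] r].
- by split=> [r rS|]; apply: h; rewrite mem_rcons inE ?eqxx ?rS ?orbT.
- by rewrite mem_rcons inE => /predU1P[->|rS]; [exact: h'|exact: h].
Qed.

(** * The coloring strategy *)

(** With [j = 0] included, every color reaches level 0 even if [p] dominates
    points of another color, so that such a [p] needs no separate treatment. *)
Definition reach {R : realType} {n} (S : seq (plane R * 'I_n)) p c j : Prop :=
  j = 0 \/ exists u, [/\ in_wedge u p, colored S u c & j <= wsize S u].

(** The invariant of the strategy.  Two wedges of different colors suffice, as a
    new point enlarges wedges of one color only. *)
Definition budget {R : realType} {n} (S : seq (plane R * 'I_n)) : Prop :=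
  forall u v c e, c != e -> colored S u c -> colored S v e ->
    nalive S + 'C(wsize S u, 2) + 'C(wsize S v, 2) <= size S.

Definition small_wedges {R : realType} {n} (S : seq (plane R * 'I_n)) : Prop :=
  forall u c, colored S u c -> wsize S u ^ 2 <= size S.

Lemma nalive_rcons (R : realType) n (S : seq (plane R * 'I_n)) p c :
  nalive (rcons S (p, c)) <=
    (count (fun q => alive S q && (dom p q.1 ==> (c == q.2))) S).+1.
Proof.
rewrite /nalive -[in leqLHS]cats1 count_cat /= addn0 -[leqRHS]addn1.
rewrite leq_add ?leq_b1//.
apply: eq_leq; apply: eq_count => q.
by rewrite /alive all_cat /= andbT.
Qed.

Lemma colored_alive (R : realType) n (S : seq (plane R * 'I_n)) u c q :
  colored S u c -> q \in S -> in_wedge u q.1 -> alive S q.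
Proof.
move=> uc qS uq; apply/allP => r rS; apply/implyP => rq.
by rewrite (uc r rS (in_wedge_dom rq uq)) (uc q qS uq).
Qed.

(** The points of [u] are alive before [p] and dead after it. *)
Lemma nalive_kill (R : realType) n (S : seq (plane R * 'I_n)) p c u m :
  colored S u m -> {in S, forall q, in_wedge u q.1 -> dom p q.1} -> c != m ->
  nalive (rcons S (p, c)) + wsize S u <= (nalive S).+1.
Proof.
move=> um up cm.
apply: leq_trans (leq_add (nalive_rcons _ _ _) (leqnn _)) _.
rewrite addSn ltnS /nalive /wsize.
rewrite -count_predUI [X in _ + X](@eq_in_count _ _ pred0) ?count_pred0 ?addn0;
  last first.
  move=> q qS /=; apply/negP => /andP[/andP[_ h] uq].
  move: h; rewrite (up q qS uq) (um q qS uq) /= => /eqP cE.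
  by rewrite cE eqxx in cm.
have -> : count (alive S) S =
    count (predU (alive S) (fun q => in_wedge u q.1)) S.
  apply: eq_in_count => q qS /=; case: (boolP (in_wedge u q.1)) => [uq|_].
  + by rewrite (colored_alive um qS uq).
  + by rewrite orbF.
by apply: sub_count => q /= /orP[/andP[->]|->] //; rewrite orbT.
Qed.

(** A point to the left of [p] is in a wedge around [p] as soon as it is low enough.
    So of two such points from two wedges the lower one is in both, which is
    impossible for different colors.  The same holds for points below [p]. *)
Lemma side_clash (R : realType) (S : seq (plane R * 'I_3)) p
    (W : 'I_3 -> \bar R * \bar R) (f : 'I_3 -> plane R * 'I_3) (a b : 'I_3) :
  (forall c, in_wedge (W c) p) -> (forall c, colored S (W c) c) ->
  (forall c, f c \in S) -> (forall c, in_wedge (W c) (f c).1) ->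
  ((f a).1.1 < p.1 -> (f b).1.1 < p.1 -> a = b)%R /\
  ((f a).1.2 < p.2 -> (f b).1.2 < p.2 -> a = b)%R.
Proof.
move=> Wp Wc fS fW.
have fc c d : in_wedge (W d) (f c).1 -> c = d.
  by move=> h; rewrite -(Wc d _ (fS c) h) (Wc c _ (fS c) (fW c)).
have [[/andP[pa1 pa2] /andP[pb1 pb2]]] := (Wp a, Wp b).
have [[/andP[fa1 fa2] /andP[fb1 fb2]]] := (fW a, fW b).
split=> ha hb.
- have [h|h] := leP (f a).1.2 (f b).1.2.
  + apply: fc; apply/andP; split; first by apply: lt_trans pb1; rewrite lte_fin.
    by apply: le_lt_trans fb2; rewrite lee_fin.
  + apply/esym/fc/andP; split; first by apply: lt_trans pa1; rewrite lte_fin.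
    by apply: lt_trans fa2; rewrite lte_fin.
- have [h|h] := leP (f a).1.1 (f b).1.1.
  + apply: fc; apply/andP; split; last by apply: lt_trans pb2; rewrite lte_fin.
    by apply: le_lt_trans fb1; rewrite lee_fin.
  + apply/esym/fc/andP; split; last by apply: lt_trans pa2; rewrite lte_fin.
    by apply: lt_trans fa1; rewrite lte_fin.
Qed.

(** A wedge with a point not above [p] has a point to the left of [p] or below
    [p].  Among three such wedges two are on the same side, against
    [side_clash]. *)
Lemma middle_wedge (R : realType) (S : seq (plane R * 'I_3)) p
    (W : 'I_3 -> \bar R * \bar R) :
  (forall c, in_wedge (W c) p) -> (forall c, colored S (W c) c) ->
  exists m, {in S, forall q, in_wedge (W m) q.1 -> dom p q.1}.
Proof.
move=> Wp Wc; apply: contrapT => /forallNP none.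
have /choice[f fP] : forall c : 'I_3, exists q : plane R * 'I_3,
    [/\ q \in S, in_wedge (W c) q.1 & ~~ dom p q.1].
  move=> c; apply: contrapT => /forallNP h; apply: (none c) => q qS Wq.
  by apply: contrapT => /negP nd; apply: (h q).
have fS c : f c \in S by case: (fP c).
have fW c : in_wedge (W c) (f c).1 by case: (fP c).
have side c : ((f c).1.1 < p.1)%R || ((f c).1.2 < p.2)%R.
  by rewrite !ltNge -negb_and; case: (fP c).
have clash a b := @side_clash _ _ _ _ _ a b Wp Wc fS fW.
pose i0 : 'I_3 := inord 0; pose i1 : 'I_3 := inord 1; pose i2 : 'I_3 := inord 2.
have [n01 n02 n12] : [/\ i0 <> i1, i0 <> i2 & i1 <> i2].
  by split=> /(congr1 val); rewrite /= !inordK.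
have [c01 d01] := clash i0 i1; have [c02 d02] := clash i0 i2.
have [c12 d12] := clash i1 i2.
case/orP: (side i0) => h0; case/orP: (side i1) => h1; case/orP: (side i2) => h2;
by [exact: n01 (c01 _ _)|exact: n01 (d01 _ _)|exact: n02 (c02 _ _)
   |exact: n02 (d02 _ _)|exact: n12 (c12 _ _)|exact: n12 (d12 _ _)].
Qed.

Lemma reach_level (R : realType) (S : seq (plane R * 'I_3)) p :
  exists x, (forall c, reach S p c x) /\ (exists c, ~ reach S p c x.+1).
Proof.
pose P j := `[< forall c, reach S p c j >].
have P0 : exists j, P j by exists 0; apply/asboolP => c; left.
have Pmax j : P j -> j <= size S.
  move=> /asboolP /(_ ord0)[->//|[u [_ _ h]]].
  exact: leq_trans h (count_size _ _).
case: (ex_maxnP P0 Pmax) => x /asboolP xP xmax; exists x; split=> //.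
apply: contrapT => /forallNP h.
suff /xmax : P x.+1 by rewrite ltnn.
by apply/asboolP => c; apply: contrapT => /h.
Qed.

(** The two alternatives are the two ways in which the growth of a wedge around
    [p] from at most [x] to [x + 1] is paid: by a larger wedge of a third color, or
    by [x] deaths. *)
Lemma good_color (R : realType) (S : seq (plane R * 'I_3)) p :
  exists c x, [/\ forall d, reach S p d x, ~ reach S p c x.+1
    & (forall d, d != c -> reach S p d x.+1) \/
      nalive (rcons S (p, c)) + x <= (nalive S).+1].
Proof.
have [x [xall [c0 c0x]]] := reach_level S p.
have [|] := pselect (forall d, d != c0 -> reach S p d x.+1).
  by exists c0, x; split=> //; left.
move=> /existsNP[c1 /not_implyP[c10 c1x]].
case: x xall c0x c1x => [|x] xall c0x c1x.
  exists c0, 0; split=> //; right; rewrite addn0.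
  apply: leq_trans (nalive_rcons _ _ _) _; rewrite ltnS.
  by apply: sub_count => q /andP[].
have /choice[W WP] : forall d, exists u,
    [/\ in_wedge u p, colored S u d & x < wsize S u].
  by move=> d; case: (xall d).
have [m mP] : exists m, {in S, forall q, in_wedge (W m) q.1 -> dom p q.1}.
  by apply: middle_wedge => d; case: (WP d).
have [c cm cx] : exists2 c, c != m & ~ reach S p c x.+2.
  have [E|] := eqVneq c0 m; last by exists c0.
  by exists c1; rewrite -?E.
(* The points of the middle wedge die, as [c] is not its color. *)
exists c, x.+1; split=> //; right.
have [_ Wm xW] := WP m.
by apply: leq_trans (nalive_kill Wm mP cm); rewrite leq_add2l.
Qed.

(** The wedges of the three colors are disjoint and consist of alive points. *)
Lemma nalive_ge (R : realType) (S : seq (plane R * 'I_3)) p x :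
  (forall c, reach S p c x) -> 3 * x <= nalive S.
Proof.
case: x => [//|x] xall.
have H c : x.+1 <= count (fun q => alive S q && (q.2 == c)) S.
  case: (xall c) => // -[u [_ uc h]]; apply: leq_trans h _.
  rewrite /wsize (@eq_in_count _ _
    (fun q => [&& in_wedge u q.1, alive S q & q.2 == c])).
    by apply: sub_count => q /= /andP[].
  move=> q qS /=; case: (boolP (in_wedge u q.1)) => //= uq.
  by rewrite (colored_alive uc qS uq) (uc q qS uq) eqxx.
rewrite /nalive -sum1_count (partition_big snd predT) //=.
rewrite -[X in X * _]card_ord -sum_nat_const.
by apply: leq_sum => c _; rewrite sum1_count.
Qed.

Lemma reach_wedges (R : realType) (S : seq (plane R * 'I_3)) p x c :
  0 < x -> reach S p c x -> exists2 u, colored S u c & x <= wsize S u.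
Proof. by case: x => [//|x] _ [//|[u [_ ? ?]]]; exists u. Qed.

(** Three wedges of size [x] give [3 * x] alive points, and two of them have
    binomials adding up to [x * (x - 1)]; together this is [(x + 1) ^ 2 - 1]. *)
Lemma level_bound (R : realType) (S : seq (plane R * 'I_3)) p x :
  budget S -> (forall c, reach S p c x) -> x.+1 ^ 2 <= (size S).+1.
Proof.
move=> B xall; case: (posnP x) => [->//|x0].
have [u uc ux] := reach_wedges x0 (xall ord0).
have [v vc vx] := reach_wedges x0 (xall ord_max).
have := B u v _ _ (isT : ord0 != ord_max :> 'I_3) uc vc.
have := nalive_ge xall.
have := leq_bin2l 2 ux; have := leq_bin2l 2 vx.
have := mul_bin_diag x 1; rewrite bin1.
by rewrite -mulnn; case: x {xall ux vx} x0 => [//|x] _ /=; nia.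
Qed.

(** Of two wedges of different colors at most one contains the new point, and only
    this one grows. *)
Lemma color_step (R : realType) (S : seq (plane R * 'I_3)) p :
  exists c, budget S /\ small_wedges S ->
    budget (rcons S (p, c)) /\ small_wedges (rcons S (p, c)).
Proof.
have [c [x [xall cx alt]]] := good_color S p.
exists c => -[B sm].
have size_le u : in_wedge u p -> colored S u c -> wsize S u <= x.
  move=> up uc; rewrite leqNgt; apply/negP => h; apply: cx; right; by exists u.
have nle : nalive (rcons S (p, c)) <= (nalive S).+1.
  apply: leq_trans (nalive_rcons _ _ _) _; rewrite ltnS.
  by apply: sub_count => q /andP[].
have one u v e : in_wedge u p -> ~~ in_wedge v p -> c != e ->
    colored S u c -> colored S v e ->
    nalive (rcons S (p, c)) + 'C((wsize S u).+1, 2) + 'C(wsize S v, 2)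
      <= (size S).+1.
  move=> up vp ce uc ve; have ux := size_le u up uc.
  case: alt => [other|kill]; last first.
    by have := B u v c e ce uc ve; rewrite binS bin1; lia.
  (* A wedge of the third color [d] has size at least [x + 1], so it can stand in
     for the grown wedge next to [v]. *)
  have [d dc de] := third_color c e.
  have [w wd wx] := reach_wedges (ltn0Sn x) (other d dc).
  have := B w v d e de wd ve.
  have : 'C((wsize S u).+1, 2) <= 'C(wsize S w, 2).
    by apply: leq_bin2l; apply: leq_trans wx; rewrite ltnS.
  lia.
split.
- move=> u v a b ab /colored_rcons[ua pa] /colored_rcons[vb pb].
  rewrite !wsize_rcons size_rcons /=.
  case: (boolP (in_wedge u p)) pa => [up /(_ isT) /= E|up _];
  case: (boolP (in_wedge v p)) pb => [vp /(_ isT) /= E'|vp _].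
  + by rewrite -E -E' eqxx in ab.
  + by subst a; rewrite add1n add0n; exact: (one u v b).
  + subst b; rewrite add1n add0n addnAC; apply: (one v u a) => //.
    by rewrite eq_sym.
  + by rewrite !add0n; have := B u v a b ab ua vb; lia.
- move=> u a /colored_rcons[ua pa]; rewrite wsize_rcons size_rcons /=.
  case: (boolP (in_wedge u p)) pa => [up /(_ isT) /= E|up _].
  + subst a; apply: leq_trans (level_bound B xall).
    by rewrite leq_exp2r // add1n ltnS; apply: size_le.
  + by rewrite add0n; apply: leq_trans (sm u a ua) _.
Qed.

Lemma online_strategy (R : realType) :
  exists A : online_algorithm R 3,
    forall s, budget (run A s) /\ small_wedges (run A s).
Proof.
have /choice[f fP] : forall Sp : seq (plane R * 'I_3) * plane R,
    exists c, budget Sp.1 /\ small_wedges Sp.1 ->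
      budget (rcons Sp.1 (Sp.2, c)) /\ small_wedges (rcons Sp.1 (Sp.2, c)).
  by move=> [S p]; exact: color_step.
exists (fun S p => f (S, p)); elim/last_ind => [|s p IH].
  by split=> [u v c e _ _ _|u c _] /=; rewrite /wsize.
by rewrite run_rcons; exact: (fP (_, p)).
Qed.

Lemma wedge_sizeE (R : realType) n (S : seq (plane R * 'I_n)) u :
  wedge_size S [set p | (p.1%:E < u.1)%E /\ (p.2%:E < u.2)%E] = wsize S u.
Proof.
apply: eq_count => q; apply/idP/idP; first by rewrite inE => -[? ?]; apply/andP.
by move=> /andP[? ?]; rewrite inE.
Qed.

Lemma mono_wedge_colored (R : realType) n (S : seq (plane R * 'I_n)) k :
  0 < k -> has_mono_wedge S k -> exists u c, colored S u c /\ wsize S u = k.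
Proof.
move=> k0 [W [[x [y [_ _ ->]]] mono sz]].
have kE : wsize S (x, y) = k by rewrite -sz -wedge_sizeE.
have /hasP[q qS uq] : has (fun q => in_wedge (x, y) q.1) S.
  by rewrite has_count -/(wsize S (x, y)) kE.
exists (x, y), q.2; split=> // r rS /andP[rx ry]; apply: mono => //.
by case/andP: uq.
Qed.

(** * The adversary *)

(** The apex is finite so that there is room for points outside the wedge. *)
Definition pile {R : realType} {n} (S : seq (plane R * 'I_n)) (x y : R) c k :=
  colored S (x%:E, y%:E) c /\ wsize S (x%:E, y%:E) = k.

Lemma in_wedge_fin (R : realType) (x y : R) (p : plane R) :
  in_wedge (x%:E, y%:E) p = ((p.1 < x) && (p.2 < y))%R.
Proof. by rewrite /in_wedge !lte_fin. Qed.

Lemma pile_mono (R : realType) n (S : seq (plane R * 'I_n)) x y c k :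
  pile S x y c k -> has_mono_wedge S k.
Proof.
move=> [col sz].
exists [set p : plane R | (p.1%:E < x%:E)%E /\ (p.2%:E < y%:E)%E]%classic.
split; first by exists x%:E, y%:E.
- move=> q r qS rS [q1 q2] [r1 r2].
  by rewrite (col q qS) ?(col r rS) //; apply/andP.
- by rewrite -sz -wedge_sizeE.
Qed.

Lemma pile_add (R : realType) n (S : seq (plane R * 'I_n)) x y c k p :
  pile S x y c k -> (p.1 < x)%R -> (p.2 < y)%R ->
  pile (rcons S (p, c)) x y c k.+1.
Proof.
move=> [col sz] px py; split; first exact/colored_rcons.
by rewrite wsize_rcons in_wedge_fin /= px py sz.
Qed.

(** This is how a side wedge survives the arrival of a point of another color: its
    apex is lowered just enough to leave that point outside. *)
Lemma pile_keep (R : realType) n (S : seq (plane R * 'I_n)) x y x' y' c k p d :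
  pile S x y c k ->
  {in S, forall q, in_wedge (x'%:E, y'%:E) q.1 = in_wedge (x%:E, y%:E) q.1} ->
  ~~ in_wedge (x'%:E, y'%:E) p -> pile (rcons S (p, d)) x' y' c k.
Proof.
move=> [col sz] same np; split.
- apply/colored_rcons; split; last by rewrite (negPf np).
  by move=> q qS; rewrite same //; apply: col.
- by rewrite wsize_rcons (negPf np) add0n -sz; exact: eq_in_count.
Qed.

(** A common point of the two piles would have both colors. *)
Lemma pile_meet (R : realType) n (S : seq (plane R * 'I_n)) x y c k x' y' c' k' e :
  c != c' -> pile S x y c k -> pile S x' y' c' k' -> (x <= x')%R -> (y' <= y)%R ->
  pile S x y' e 0.
Proof.
move=> cc' [col _] [col' _] xx yy.
have none : {in S, forall q, in_wedge (x%:E, y'%:E) q.1 = false}.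
  move=> q qS; apply/negP; rewrite in_wedge_fin => /andP[qx qy].
  move/eqP: cc'; apply; rewrite -(col q qS) ?(col' q qS) // in_wedge_fin.
  - by rewrite qy (lt_le_trans qx).
  - by rewrite qx (lt_le_trans qy).
split=> [q qS|]; first by rewrite none.
by rewrite /wsize (eq_in_count (a2 := pred0)) ?count_pred0.
Qed.

Lemma gap_below (R : realType) (xs : seq R) (b : R) :
  exists2 c, (c < b)%R & {in xs, forall x, x < b -> x < c}%R.
Proof.
elim: xs => [|x xs [c cb IH]]; first by exists (b - 1)%R => //; lra.
have [xb|bx] := ltP x b; last first.
  exists c => // z; rewrite inE => /predU1P[->|]; last exact: IH.
  by rewrite ltNge bx.
have mb : (Num.max c x < b)%R by rewrite gt_max cb.
have [lo hi] := midf_lt mb.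
exists ((Num.max c x + b) / 2%:R)%R => // z; rewrite inE => /predU1P[->|zx] zb.
- by apply: le_lt_trans lo; rewrite le_max lexx orbT.
- by apply: lt_trans lo; rewrite lt_max IH.
Qed.

Lemma upper_bound (R : realType) (xs : seq R) (b : R) :
  exists2 c, (b <= c)%R & {in xs, forall x, x < c}%R.
Proof.
elim: xs => [|x xs [c cb IH]]; first by exists b.
exists (Num.max c (x + 1))%R; first by rewrite le_max cb.
move=> z; rewrite inE => /predU1P[->|zx]; rewrite lt_max; last by rewrite IH.
by rewrite ltrDl ltr01 orbT.
Qed.

(** The left pile is narrow and tall, the right one wide and low, and the middle one
    is between them in both directions.  The order of the coordinates makes the
    corner [(x, y)] the apex of the intersection of the three wedges, which has no
    points since their colors differ. *)
Variant position {R : realType} (S : seq (plane R * 'I_3)) a b m : Prop :=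
  Position (x y X Y XR YL : R) (cl cr cm : 'I_3) of
    cl != cr & cl != cm & cr != cm
  & (x <= X)%R & (X <= XR)%R & (y <= Y)%R & (Y <= YL)%R
  & pile S x YL cl a & pile S XR y cr b & pile S X Y cm m.

(** The middle pile becomes the left one, and the old left pile is abandoned.  The
    new middle wedge is the intersection of the two remaining ones. *)
Lemma promote_left (R : realType) (S : seq (plane R * 'I_3)) a b m :
  position S a b m -> position S m b 0.
Proof.
case=> x y X Y XR YL cl cr cm lr lm rm xX XXR yY YYL L Rt M.
apply: (@Position _ _ _ _ _ X y X y XR Y cm cr cl) => //; rewrite 1?eq_sym //.
by apply: (pile_meet _ _ M Rt); rewrite 1?eq_sym.
Qed.

Lemma promote_right (R : realType) (S : seq (plane R * 'I_3)) a b m :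
  position S a b m -> position S a m 0.
Proof.
case=> x y X Y XR YL cl cr cm lr lm rm xX XXR yY YYL L Rt M.
apply: (@Position _ _ _ _ _ x Y x Y X YL cl cm cr) => //; rewrite 1?eq_sym //.
exact: (pile_meet _ lm L M).
Qed.

(** The new point is in the corner common to the three wedges, and so close to its
    apex that every old point to the left of the apex is to the left of the new
    point, and likewise below.  Hence each of the left and the right wedge can be
    cut to exclude the new point without losing an old one. *)
Lemma adversary_step (R : realType) (S : seq (plane R * 'I_3)) a b m :
  position S a b m -> exists2 p, p \notin map fst S & forall c,
    [\/ position (rcons S (p, c)) a.+1 b 0,
        position (rcons S (p, c)) a b.+1 0
      | position (rcons S (p, c)) a b m.+1].
Proof.
case=> x y X Y XR YL cl cr cm lr lm rm xX XXR yY YYL L Rt M.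
have [px pxx pxS] := gap_below [seq q.1.1 | q <- S] x.
have [py pyy pyS] := gap_below [seq q.1.2 | q <- S] y.
have eqx q : q \in S -> (q.1.1 < px)%R = (q.1.1 < x)%R.
  move=> qS; apply/idP/idP => [h|]; first exact: lt_trans pxx.
  by apply: pxS; apply/mapP; exists q.
have eqy q : q \in S -> (q.1.2 < py)%R = (q.1.2 < y)%R.
  move=> qS; apply/idP/idP => [h|]; first exact: lt_trans pyy.
  by apply: pyS; apply/mapP; exists q.
exists (px, py).
  apply/negP => /mapP[q qS E].
  by have := eqx q qS; rewrite -E /= ltxx pxx.
move=> c; case: (color_cases c lr lm rm) => ->.
- constructor 1.
  have R' : pile (rcons S ((px, py), cl)) XR py cr b.
    apply: (pile_keep _ Rt) => [q qS|]; first by rewrite !in_wedge_fin eqy.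
    by rewrite in_wedge_fin /= ltxx andbF.
  have L' : pile (rcons S ((px, py), cl)) x YL cl a.+1.
    by apply: (pile_add L) => //=; lra.
  apply: (@Position _ _ _ _ _ x py x py XR YL cl cr cm) => //; try lra.
  by apply: (pile_meet _ lr L' R'); lra.
- constructor 2.
  have L' : pile (rcons S ((px, py), cr)) px YL cl a.
    apply: (pile_keep _ L) => [q qS|]; first by rewrite !in_wedge_fin eqx.
    by rewrite in_wedge_fin /= ltxx.
  have R' : pile (rcons S ((px, py), cr)) XR y cr b.+1.
    by apply: (pile_add Rt) => //=; lra.
  apply: (@Position _ _ _ _ _ px y px y XR YL cl cr cm) => //; try lra.
  by apply: (pile_meet _ lr L' R'); lra.
- constructor 3.
  have L' : pile (rcons S ((px, py), cm)) px YL cl a.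
    apply: (pile_keep _ L) => [q qS|]; first by rewrite !in_wedge_fin eqx.
    by rewrite in_wedge_fin /= ltxx.
  have R' : pile (rcons S ((px, py), cm)) XR py cr b.
    apply: (pile_keep _ Rt) => [q qS|]; first by rewrite !in_wedge_fin eqy.
    by rewrite in_wedge_fin /= ltxx andbF.
  have M' : pile (rcons S ((px, py), cm)) X Y cm m.+1.
    by apply: (pile_add M) => /=; lra.
  by apply: (@Position _ _ _ _ _ px py X Y XR YL cl cr cm) => //; lra.
Qed.

(** A bound for the points spent on side piles of sizes [a] and [b].  An increment
    costs at most one more than the smaller side, and along the balanced path
    (0,0), (1,0), (1,1), (2,1), ... these bounds add up exactly to the product.
    Along any other path they add up to at most the product ([cost_step]). *)
Definition cost a b := (minn a b).+1 * maxn a b.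

Lemma costC a b : cost a b = cost b a.
Proof. by rewrite /cost minnC maxnC. Qed.

Lemma cost_step a b : cost a b + (minn a b).+1 <= cost a.+1 b.
Proof. by rewrite /cost; case: (leqP a b); case: (leqP a.+1 b); nia. Qed.

Lemma cost_bound a b k : a < k -> b < k -> cost a b + (minn a b).+1 <= k ^ 2.
Proof. by rewrite -mulnn /cost; case: (leqP a b); nia. Qed.

(** A middle pile is kept only up to the size of the smaller side: at that size it is
    lost through a growing side, or grows and replaces that side.  So the middle
    points are paid for by the increase of [cost]. *)
Lemma adversary_wins (R : realType) (A : online_algorithm R 3) k s a b m :
  position (run A s) a b m -> uniq s -> m <= minn a b -> a < k -> b < k ->
  size s <= cost a b + m ->
  exists s', [/\ uniq s', size s' <= k ^ 2
    & exists x y c, pile (run A s') x y c k].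
Proof.
have [d] := ubnP (k ^ 2 - size s); elim: d => [//|d IH] in s a b m *.
move=> dk pos us mab ak bk sz.
have bound := cost_bound ak bk.
have [p ps next] := adversary_step pos.
rewrite points_run in ps.
have us' : uniq (rcons s p) by rewrite rcons_uniq ps.
have dk' : k ^ 2 - size (rcons s p) < d by rewrite size_rcons; lia.
have sz' : size (rcons s p) <= k ^ 2 by rewrite size_rcons; lia.
have wonl : position (run A (rcons s p)) a.+1 b 0 ->
    exists s', [/\ uniq s', size s' <= k ^ 2
      & exists x y c, pile (run A s') x y c k].
  move=> pos'; have [E|ne] := eqVneq a.+1 k.
    exists (rcons s p); split=> //; case: pos' => x ? ? ? ? YL cl ? ? ? ? ? ? ? ? ?.
    by rewrite E => L _ _; exists x, YL, cl.
  apply: (IH _ _ _ _ dk' pos') => //; first by rewrite ltn_neqAle ne.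
  by have := cost_step a b; rewrite size_rcons; lia.
have wonr : position (run A (rcons s p)) a b.+1 0 ->
    exists s', [/\ uniq s', size s' <= k ^ 2
      & exists x y c, pile (run A s') x y c k].
  move=> pos'; have [E|ne] := eqVneq b.+1 k.
    exists (rcons s p); split=> //; case: pos' => ? y ? ? XR ? ? cr ? ? ? ? ? ? ? ?.
    by rewrite E => _ Rt _; exists XR, y, cr.
  apply: (IH _ _ _ _ dk' pos') => //; first by rewrite ltn_neqAle ne.
  have := cost_step b a; rewrite size_rcons (costC b a) (costC _ a) minnC; lia.
case: (next (A (run A s) p)); rewrite -run_rcons => // pos'.
have [mlt|mge] := ltnP m (minn a b).
  by apply: (IH _ _ _ _ dk' pos') => //; rewrite size_rcons; lia.
(* The middle pile has just outgrown the smaller side, which it replaces. *)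
have [ab|ba] := leqP a b.
- have am : a = m by lia.
  by apply: wonl; rewrite am; apply: promote_left pos'.
- have bm : b = m by lia.
  by apply: wonr; rewrite bm; apply: promote_right pos'.
Qed.

(** Points on the boundary of the wedge and far to the right are new and outside
    it. *)
Lemma pad (R : realType) (A : online_algorithm R 3) s x y c k n :
  uniq s -> size s <= n -> pile (run A s) x y c k ->
  exists s', [/\ uniq s', size s' = n & pile (run A s') x y c k].
Proof.
elim: n => [|n IH] in s *; first by rewrite leqn0 => us /eqP ? ?; exists s.
rewrite leq_eqVlt ltnS => us /predU1P[|sn pl]; first by exists s.
have [t [ut st pt]] := IH s us sn pl.
have [z xz zt] := upper_bound (map fst t) x.
exists (rcons t (z, y)); split; last 2 first.
- by rewrite size_rcons st.
- rewrite run_rcons; apply: (pile_keep _ pt) => //.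
  by rewrite in_wedge_fin /= ltxx andbF.
- rewrite rcons_uniq ut andbT; apply/negP => zyt.
  have : (z < z)%R by apply: zt; apply/mapP; exists (z, y).
  by rewrite ltxx.
Qed.

Theorem theorem3 (R : realType) (k : nat) (hk : 0 < k) :
  (forall A : online_algorithm R 3,
     exists s : seq (plane R),
       [/\ uniq s, size s = k ^ 2 & has_mono_wedge (run A s) k])
  /\
  (exists A : online_algorithm R 3,
     forall s : seq (plane R),
       uniq s -> size s = k ^ 2 - 1 -> ~ has_mono_wedge (run A s) k).
Proof.
split=> [A|].
- (* The piles are empty, so their colors are arbitrary. *)
  have start : position (run A [::]) 0 0 0.
    have [c c0 c1] := third_color ord0 ord_max.
    by apply: (@Position _ _ _ _ _ 0%R 0%R 0%R 0%R 0%R 0%R ord0 ord_max c);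
      rewrite 1?eq_sym.
  have [s [us sk [x [y [c pl]]]]] := adversary_wins start isT isT hk hk isT.
  have [t [ut st pt]] := pad us sk pl.
  by exists t; split=> //; apply: pile_mono pt.
- have [A AP] := online_strategy R; exists A => s _ sz /(mono_wedge_colored hk).
  move=> [u [c [col uk]]]; have [_ small] := AP s.
  have := small u c col; rewrite uk size_run sz.
  have : 0 < k ^ 2 by rewrite expn_gt0 hk.
  lia.
Qed.
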